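(* Let $D$ be a positive integer. If $G$ is a graph with $\mathrm{mad}(G)<4$ and $\Delta(G)\le D$, then $\omega(G^2)\le \frac52 D+532$.
   Context: The maximum average degree of $G$ is $\mathrm{mad}(G)=\max_{H\subseteq G} 2|E(H)|/|V(H)|$ over nonempty subgraphs $H$. The square $G^2$ of $G$ is obtained from $G$ by adding an edge between every pair of vertices at distance 2 in $G$. $\omega(\cdot)$ denotes clique number and $\Delta(\cdot)$ maximum degree. *)

(* Defs.v *)
From mathcomp Require Import all_boot all_order all_algebra.
Set Implicit Arguments. Unset Strict Implicit. Unset Printing Implicit Defensive.
Import Order.TTheory GRing.Theory Num.Theory.
Local Open Scope ring_scope.

Definition simple_graph (T : finType) (e : rel T) : Prop :=
  symmetric e /\ irreflexive e.

(* A subgraph H of G is given by a vertex set S and an edge set F, where F is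
   a symmetric set of ordered pairs (each undirected edge {u,v} is recorded as
   both (u,v) and (v,u)), contained in the edges of G, with endpoints in S.
   Hence #|F| = 2 |E(H)|. *)
Definition is_subgraph (T : finType) (e : rel T) (S : {set T}) (F : {set T * T}) : bool :=
  [forall p : T * T, (p \in F) ==>
     [&& e p.1 p.2, p.1 \in S, p.2 \in S & ((p.2, p.1) \in F)]].

Definition mad (T : finType) (e : rel T) : rat :=
  \big[Num.max/0]_(H : {set T} * {set T * T} | (H.1 != set0) && is_subgraph e H.1 H.2)
     ((#|H.2|)%:R / (#|H.1|)%:R).

Definition deg (T : finType) (e : rel T) (v : T) : nat := #|[set u | e v u]|.

Definition max_deg (T : finType) (e : rel T) : nat := (\max_(v : T) deg e v)%N.

Definition square (T : finType) (e : rel T) : rel T :=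
  fun u v => (u != v) && (e u v || [exists w, e u w && e w v]).

Definition is_clique (T : finType) (e : rel T) (K : {set T}) : bool :=
  [forall u in K, forall v in K, (u != v) ==> e u v].

Definition clique_number (T : finType) (e : rel T) : nat :=
  (\max_(K : {set T} | is_clique e K) #|K|)%N.

(* Main.v *)
Require Import Defs.
From mathcomp Require Import all_boot all_order all_algebra.
From mathcomp Require Import zify lra.
Set Implicit Arguments. Unset Strict Implicit. Unset Printing Implicit Defensive.
Import Order.TTheory GRing.Theory Num.Theory.

(* Let A be a clique of G^2 and d(v) the number of neighbours of v in A. Applied
   to A and the vertices outside A with d(v) > 2, mad(G) < 4 gives
   sum_(A) d + 2 sum_(outside A) (d - 2)^+ < 4 |A|, while each x in A satisfies
   |A| - 1 <= D + sum_(v ~ x) s(v), where the surplus s(v) is d(v) - 2 outside A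
   and d(v) - 1 inside A.  Discarding fewer than 80 vertices we may assume
   8 d <= D on A.  Distributing the charge D(d(v) - 2) of each outside vertex
   (and D/2 per incidence inside A) over the neighbours in A, the total is below
   2D|A|; but if |A| > 5D/2 every x receives at least 2D - 16, and D/3 more unless
   x is normal: all its neighbours are outside A, exactly two are hubs (4d > D) and
   the others have surplus 0.  So all but a bounded number of vertices are normal.
   The normal vertices are the edges of a weighted graph on the hubs, with degrees
   at most D, in which each edge is disjoint from at most D others; looking at a
   hub of minimum degree shows that such a graph has at most 5D/2 edges. *)

(** * Degrees into a set; multigraphs whose edges mostly intersect *)

Definition degin (T : finType) (e : rel T) (A : {set T}) (v : T) : nat :=
  #|[set u in A | e v u]|.

(** Read [w] as edge multiplicity and [p] as the number of edges: [d u + d v - w u v] edges meet the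
    pair, so the last hypothesis allows at most [D] edges disjoint from a given one. The five-cycle
    with all multiplicities D/2 attains the bound. *)
Lemma weighted_graph_bound (T : finType) (H : {set T}) (w : T -> T -> nat)
    (d : T -> nat) (D p : nat) :
  (forall u, u \in H -> 0 < d u <= D) ->
  (forall u, u \in H -> d u = \sum_(v in H :\ u) w u v) ->
  \sum_(u in H) d u = 2 * p ->
  (forall u v, u \in H -> v \in H -> u != v -> 0 < w u v ->
     p + w u v <= D + d u + d v) ->
  2 * p <= 5 * D.
Proof.
move=> dH dE sumd cov; rewrite leqNgt; apply/negP => pD.
have [u0 u0H] : exists u0, u0 \in H.
  apply/set0Pn; apply: contraTneq pD => H0; move: sumd; rewrite H0 big_set0; lia.
case: (arg_minnP (P := mem H) d u0H) => u uH0 umin; have uH : u \in H := uH0.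
have sumD : \sum_(v in H :\ u) d v + d u = 2 * p.
  by rewrite -sumd [RHS](big_setD1 u uH) /= addnC.
have cardH : #|H| = #|H :\ u|.+1 by rewrite (cardsD1 u) uH.
have m6 : 6 <= #|H|.
  have : 2 * p <= #|H| * D.
    by rewrite -sumd -sum_nat_const; apply: leq_sum => v /dH /andP[].
  by nia.
have /andP[du0 duD] := dH u uH.
have minsum : #|H| * d u <= 2 * p.
  by rewrite -sumd -sum_nat_const; apply: leq_sum => v /umin.
(* If p <= D + 2 d(u), the upper bound on w u v is nonnegative for every v, so it
   may be summed over all v != u; otherwise only over the neighbours of u. *)
have [large|small] := leqP p (D + 2 * d u).
  (* Here [d u] exceeds 3D/4, while [minsum] gives [(#|H| - 4) * d u <= 2 * D]. *)
  have cardH6 : #|H| = 6 by nia.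
  have : \sum_(v in H :\ u) (w u v + p) <= \sum_(v in H :\ u) (D + d u + d v).
    apply: leq_sum => v; rewrite in_setD1 => /andP[vu vH].
    have [w0|w0] := posnP (w u v); first by have := umin v vH; lia.
    by rewrite addnC; apply: cov; rewrite // eq_sym.
  rewrite !big_split /= !sum_nat_const -(dE u uH).
  have := cardH; rewrite cardH6 => -[<-]; lia.
pose N := [set v in H :\ u | 0 < w u v].
have NH v : v \in N -> [/\ v \in H, u != v & 0 < w u v].
  by rewrite !inE eq_sym => /andP[/andP[-> ->] ->].
have dN : d u = \sum_(v in N) w u v.
  rewrite (dE u uH) (bigID (fun v => 0 < w u v)) /= [X in _ + X]big1 ?addn0.
    by apply: eq_bigl => v; rewrite !inE.
  by move=> v /andP[_]; case: (w u v).
(* With three neighbours, 3p - 6D <= 2 d(u) < p - D contradicts [pD]; fewer are excluded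
   likewise. *)
have N4 : 4 <= #|N|.
  rewrite leqNgt; apply/negP => N3.
  have : \sum_(v in N) (w u v + p) <= \sum_(v in N) (2 * D + d u).
    apply: leq_sum => v /NH[vH uv w0].
    by have := cov u v uH vH uv w0; have := dH v vH; lia.
  rewrite big_split /= !sum_nat_const -dN; nia.
have sN : \sum_(v in N) (w u v + p) <= \sum_(v in N) (D + d u + d v).
  apply: leq_sum => v /NH[vH uv w0].
  by have := cov u v uH vH uv w0; lia.
(* Non-neighbours, [u] included, have degree at least [d u]; this caps the degree sum over [N]
   needed in [sN]. *)
have sC : #|H :\: N| * d u <= \sum_(v in H :\: N) d v.
  by rewrite -sum_nat_const; apply: leq_sum => v; rewrite inE => /andP[_ /umin].
have NsH : N \subset H by apply/subsetP => v /NH[].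
have cHN : #|H| = #|N| + #|H :\: N| by rewrite -(cardsID N H) (setIidPr NsH).
have sH : \sum_(v in N) d v + \sum_(v in H :\: N) d v = 2 * p.
  by rewrite -sumd [RHS](big_setID N) /= (setIidPr NsH).
move: sN; rewrite !big_split /= !sum_nat_const -dN => sN.
clear -sN sC cHN N4 sH small pD m6 du0 duD; nia.
Qed.

(** * Sparsity and covering inequalities *)

Section DegreeIntoSet.
Variables (T : finType) (e : rel T).
Hypothesis eG : simple_graph e.
Local Notation degin := (degin e).

Lemma sum_nbrs (A : {set T}) (F : T -> nat) :
  \sum_(x in A) \sum_(v | e x v) F v = \sum_v degin A v * F v.
Proof.
rewrite (exchange_big_dep predT) //=; apply: eq_bigr => v _.
rewrite sum_nat_const; congr (_ * _).
by apply: eq_card => x; rewrite inE [e v x]eG.1.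
Qed.

(** The subgraph [F] omits edges inside [W]. A vertex of [W] thus adds 2d ordered pairs to [#|F|]
    and 4 to the bound [4 * #|A :|: W|], a net 2(d - 2); truncated subtraction gives 0 outside
    [W]. *)
Lemma mad_sparse (A : {set T}) :
  (mad e < 4)%R -> A != set0 ->
  \sum_(z in A) degin A z + 2 * \sum_(v in ~: A) (degin A v - 2) < 4 * #|A|.
Proof.
move=> madG A0.
pose W := [set v in ~: A | 2 < degin A v].
pose F := [set p : T * T | e p.1 p.2 &&
   ((p.1 \in A) && (p.2 \in A :|: W) || (p.1 \in W) && (p.2 \in A))].
have dAW : [disjoint A & W].
  by rewrite -setI_eq0; apply/eqP/setP => v; rewrite !inE; case: (v \in A).
have cF : #|F| = \sum_(z in A) degin A z + 2 * \sum_(v in W) degin A v.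
  have -> : #|F| = \sum_u #|[set v | (u, v) \in F]|.
    rewrite -sum1_card (eq_bigr (fun p => (fun u v => 1) p.1 p.2)) //.
    rewrite (eq_bigl (fun p => predT p.1 && (fun u v => (u, v) \in F) p.1 p.2));
      last by case.
    rewrite -(pair_big_dep predT (fun u v => (u, v) \in F) (fun _ _ => 1)) /=.
    apply: eq_bigr => u _; rewrite -sum1_card.
    by apply: eq_bigl => v; rewrite [in RHS]inE.
  rewrite (bigID (mem A)) /= [X in _ + X](bigID (mem W)) /=.
  rewrite [X in _ + (_ + X)]big1 ?addn0; last first.
    move=> u /andP[/negPf uA /negPf uW]; apply: eq_card0 => v.
    by rewrite [LHS]inE inE /= uA uW andbF.
  rewrite (eq_bigr (fun z => degin A z + degin W z)); last first.
    move=> z zA; rewrite /degin -cardsUI [X in _ + X]eq_card0 ?addn0; last first.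
      by move=> v; rewrite !inE; case: (v \in A); rewrite ?andbF.
    apply: eq_card => v; rewrite !inE /= zA /=.
    by case: (v \in A); case: (e z v); rewrite ?orbT ?orbF ?andbF ?andbT.
  have -> : \sum_(u | (u \notin A) && (u \in W)) #|[set v | (u, v) \in F]|
     = \sum_(u in W) degin A u.
    apply: eq_big => [u|u /andP[uA uW]]; first by rewrite !inE; case: (u \in A).
    apply: eq_card => v; rewrite !inE /= (negPf uA).
    by move: uW; rewrite inE => /andP[_ ->]; rewrite /= andbC.
  rewrite big_split /= -addnA mul2n -addnn; congr (_ + (_ + _)).
  have := sum_nbrs A (fun v => v \in W : nat).
  rewrite [RHS](bigID (mem W)) /= [X in _ = _ + X]big1 ?addn0; last first.
    by move=> v /negPf ->; rewrite muln0.
  rewrite [RHS](eq_bigr (degin A)); last by move=> v ->; rewrite muln1.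
  move=> <-; apply: eq_bigr => z _.
  rewrite /degin -sum1_card [RHS]big_mkcond [LHS]big_mkcond; apply: eq_bigr => v _.
  by rewrite [v \in [set _ | _ ]]inE; case: (e z v); case: (v \in W).
have S0 : A :|: W != set0 by rewrite setU_eq0 negb_and A0.
have subF : is_subgraph e (A :|: W) F.
  apply/forallP => -[u v]; apply/implyP; rewrite !inE /= [e v u]eG.1.
  by case: (e u v); case: (u \in A); case: (v \in A);
    rewrite //= ?orbT ?orbF ?andbF ?andbT ?andbb.
have lt : #|F| < 4 * #|A :|: W|.
  have : ((#|F|)%:R / (#|A :|: W|)%:R <= mad e)%R.
    apply: (le_bigmax_cond 0%R (fun H : {set T} * {set T * T} =>
      ((#|H.2|)%:R / (#|H.1|)%:R : rat)%R) (j := (A :|: W, F))).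
    by rewrite /= S0.
  move=> /le_lt_trans /(_ madG).
  rewrite ltr_pdivrMr ?ltr0n ?card_gt0 // -natrM ltr_nat; lia.
rewrite cF cardsU (disjoint_setI0 dAW) cards0 subn0 in lt.
have -> : \sum_(v in ~: A) (degin A v - 2) = \sum_(v in W) (degin A v - 2).
  rewrite (bigID (fun v => 2 < degin A v)) /= [X in _ + X]big1 ?addn0.
    by apply: eq_bigl => v; rewrite !inE.
  move=> v /andP[_]; lia.
have : \sum_(v in W) degin A v = \sum_(v in W) (degin A v - 2) + 2 * #|W|.
  rewrite mulnC -sum_nat_const -big_split /=; apply: eq_bigr => v.
  by rewrite inE => /andP[_]; lia.
lia.
Qed.

(** A neighbour [v] of [x] covers at most [degin A v] vertices of [A] other than [x] if [v] is in
    [A] (itself included), and one fewer otherwise. The surplus is this count less one; the ones sum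
    to at most [D]. *)
Definition surplus (A : {set T}) (v : T) : nat :=
  if v \in A then degin A v - 1 else degin A v - 2.

Lemma clique_cover (A : {set T}) (D : nat) (x : T) :
  is_clique (square e) A -> max_deg e <= D -> x \in A ->
  #|A| <= D + 1 + \sum_(v | e x v) surplus A v.
Proof.
move=> cA dD xA.
have dx : #|[set v | e x v]| <= D by apply: leq_trans dD; apply: (leq_bigmax x).
pose C v := (if v \in A then [set v] else set0) :|: [set y in A | e v y] :\ x.
have sub : A :\ x \subset \bigcup_(v | e x v) C v.
  apply/subsetP => y; rewrite in_setD1 => /andP[yx yA].
  have /forall_inP /(_ x xA) /forall_inP /(_ y yA) := cA.
  rewrite /square eq_sym yx /= => /orP[exy|/existsP[v /andP[exv evy]]].
    by apply/bigcupP; exists y; rewrite // /C yA !inE eqxx.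
  by apply/bigcupP; exists v; rewrite // /C !inE yx yA evy orbT.
have -> : #|A| = #|A :\ x|.+1 by rewrite (cardsD1 x) xA.
have : #|\bigcup_(v | e x v) C v| <= \sum_(v | e x v) (1 + surplus A v).
  elim/big_rec2: _ => [|v k U exv IH]; first by rewrite cards0.
  rewrite cardsU; apply: leq_trans (leq_subr _ _) _; rewrite leq_add //.
  rewrite /C cardsU; apply: leq_trans (leq_subr _ _) _.
  have : #|[set y in A | e v y]| = #|[set y in A | e v y] :\ x|.+1.
    by rewrite (cardsD1 x) !inE xA eG.1 exv.
  rewrite /surplus /degin; case: (v \in A); rewrite ?cards1 ?cards0; lia.
have -> : \sum_(v | e x v) (1 + surplus A v)
    = #|[set v | e x v]| + \sum_(v | e x v) surplus A v.
  by rewrite big_split -sum1_card /=; congr (_ + _); apply: eq_bigl => v; rewrite inE.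
have := subset_leq_card sub; lia.
Qed.
End DegreeIntoSet.

(** * Hubs and normal vertices of a clique in the square *)

Section SquareClique.
Variables (T : finType) (e : rel T) (D : nat) (A : {set T}).
Hypotheses (eG : simple_graph e) (degD : max_deg e <= D).
Hypothesis cA : is_clique (square e) A.
Local Notation degin := (degin e).
Local Notation surplus := (surplus e).

Lemma degin_le (P : {set T}) v : degin P v <= D.
Proof.
apply: leq_trans degD; apply: leq_trans (leq_bigmax (F := deg e) v).
by apply/subset_leq_card/subsetP => y; rewrite !inE => /andP[].
Qed.

Lemma sum_cover :
  #|A| * #|A| <= #|A| * (D + 1) + \sum_v degin A v * surplus A v.
Proof.
rewrite -sum_nbrs // -!sum_nat_const -big_split /=.
by apply: leq_sum => x; apply: clique_cover.
Qed.

Definition hubs : {set T} := [set v in ~: A | D < 4 * degin A v].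

Definition hubs_of (x : T) : {set T} := [set v in hubs | e x v].

Definition normal (x : T) : bool :=
  (#|hubs_of x| == 2) &&
  [forall v, e x v ==> (v \in hubs) || (v \notin A) && (degin A v <= 2)].

Definition normals : {set T} := [set x in A | normal x].

(** A normal vertex adjacent to neither hub of [x] is reached from [x] through a non-hub neighbour,
    which sees at most one member of [A] besides [x]. So at most [D] normal vertices miss both hubs,
    and inclusion-exclusion does the rest. *)
Lemma normals_hub_cover x : x \in normals ->
  forall u v, u \in hubs -> v \in hubs -> u != v -> e x u -> e x v ->
  #|normals| + #|[set y in normals | e y u && e y v]| <=
    D + degin normals u + degin normals v.
Proof.
rewrite inE => /andP[xA /andP[/eqP two /forallP nrm]] u v uH vH uv xu xv.
have hx : hubs_of x = [set u; v].
  apply/esym/eqP; rewrite eqEcard two cards2 uv andbT.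
  by apply/subsetP => z; rewrite !inE => /orP[] /eqP ->;
    [move: uH; rewrite !inE => -> | move: vH; rewrite !inE => ->].
pose Z := [set z | e x z] :\: hubs.
pose Nb (z : T) := [set y in normals | e z y].
have sub : normals \subset Nb u :|: Nb v :|: \bigcup_(z in Z) ([set y in A | e z y] :\ x).
  apply/subsetP => y yP; have yA : y \in A by move: yP; rewrite inE => /andP[].
  rewrite !in_setU ![in _ \in Nb _]inE yP /=.
  have [->|yx] := eqVneq y x; first by rewrite [e u x]eG.1 xu.
  have /forall_inP /(_ x xA) /forall_inP /(_ y yA) := cA.
  rewrite /square eq_sym yx /= => /orP[exy|/existsP[z /andP[exz ezy]]].
    by have := nrm y; rewrite exy /= !inE yA.
  have [zH|zH] := boolP (z \in hubs).
    have : z \in hubs_of x by rewrite inE zH exz.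
    by rewrite hx !inE => /orP[] /eqP <-; rewrite ezy ?orbT.
  apply/orP; right; apply/bigcupP; exists z.
    by rewrite in_setD zH inE.
  by rewrite !inE yx yA ezy.
have cZ : #|\bigcup_(z in Z) ([set y in A | e z y] :\ x)| <= #|Z|.
  rewrite -[leqRHS]sum1_card; elim/big_rec2: _ => [|z k U zZ IH]; first by rewrite cards0.
  rewrite cardsU; apply: leq_trans (leq_subr _ _) _; rewrite leq_add //.
  move: zZ; rewrite in_setD => /andP[zH]; rewrite inE => xz.
  have := nrm z; rewrite xz (negPf zH) /= => /andP[_].
  by rewrite /degin (cardsD1 x) !inE xA [e z x]eG.1 xz.
have ZD : #|Z| <= D.
  apply: leq_trans degD; apply: leq_trans (leq_bigmax (F := deg e) x).
  by apply: subset_leq_card; rewrite subDset subsetUr.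
have wI : [set y in normals | e y u && e y v] = Nb u :&: Nb v.
  apply/setP => y; rewrite !inE ![e y _]eG.1.
  by case: (y \in A); case: normal; case: (e u y); case: (e v y).
have := subset_leq_card sub; have := cardsUI (Nb u) (Nb v); rewrite -wI.
have := cardsUI (Nb u :|: Nb v) (\bigcup_(z in Z) ([set y in A | e z y] :\ x)).
rewrite /degin -/(Nb u) -/(Nb v); lia.
Qed.

Lemma normals_bound : 2 * #|normals| <= 5 * D.
Proof.
(* Dropping hubs without normal neighbours secures the positive degrees required by
   [weighted_graph_bound]. *)
pose H := [set v in hubs | 0 < degin normals v].
pose w u v := #|[set y in normals | e y u && e y v]|.
have hubsP x : x \in normals -> [set v in H | e x v] = hubs_of x.
  move=> xP; apply/setP => v; rewrite !inE; case exv: (e x v); rewrite ?andbF //.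
  have -> : 0 < degin normals v; last by rewrite !andbT.
  by apply/card_gt0P; exists x; rewrite inE xP eG.1 exv.
have two x : x \in normals -> #|hubs_of x| = 2.
  by rewrite inE => /andP[_ /andP[/eqP]].
apply: (@weighted_graph_bound T H w (degin normals)).
- by move=> u; rewrite inE degin_le andbT => /andP[].
- move=> u uH.
  (* Each normal neighbour of [u] has exactly one other hub. *)
  transitivity (\sum_(v in H :\ u) \sum_(x in [set x in normals | e u x]) (e x v : nat)).
    rewrite exchange_big /= /degin -sum1_card; apply: eq_bigr => x.
    rewrite inE => /andP[xP eux].
    have : #|[set v in H | e x v]| = 2 by rewrite hubsP ?two.
    rewrite (cardsD1 u) inE uH eG.1 eux => -[<-].
    rewrite -sum1_card big_mkcond [RHS]big_mkcond; apply: eq_bigr => v _.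
    rewrite !in_setD1 [v \in [set _ in _ | _]]in_set.
    by case: (v != u); case: (v \in H); case: (e x v).
  apply: eq_bigr => v _; rewrite /w -sum1_card big_mkcond [RHS]big_mkcond.
  apply: eq_bigr => x _; rewrite !inE [e u x]eG.1.
  by case: (x \in A); case: (normal x); case: (e x u); case: (e x v).
- transitivity (\sum_(x in normals) \sum_(v in H) (e x v : nat)).
    rewrite exchange_big /=; apply: eq_bigr => v _.
    rewrite /degin -sum1_card big_mkcond [RHS]big_mkcond.
    apply: eq_bigr => x _; rewrite !inE [e v x]eG.1.
    by case: (x \in A); case: (normal x); case: (e x v).
  rewrite mulnC -sum_nat_const; apply: eq_bigr => x xP.
  rewrite -(two x xP) -(hubsP x xP) -sum1_card big_mkcond [RHS]big_mkcond.
  apply: eq_bigr => v _; rewrite [v \in [set _ in _ | _]]in_set.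
  by case: (v \in H); case: (e x v).
- move=> u v /setIdP[uH _] /setIdP[vH _] uv.
  rewrite card_gt0 => /set0Pn[x /setIdP[xP /andP[xu xv]]].
  exact: normals_hub_cover xP _ _ uH vH uv xu xv.
Qed.

(** * Crude bounds and discharging *)

Hypotheses (madG : (mad e < 4)%R) (D0 : 0 < D) (A0 : A != set0).

(** Bounding each surplus by [D] in [sum_cover] leaves less than [4 * D * #|A|] by [mad_sparse]. *)
Lemma square_clique_5D : #|A| <= 5 * D.
Proof.
have := mad_sparse eG madG A0; have := sum_cover.
rewrite (bigID (mem A)) /=.
have : \sum_(v in A) degin A v * surplus A v <= D * \sum_(v in A) degin A v.
  rewrite big_distrr /=; apply: leq_sum => v vA; rewrite /surplus vA.
  by have := degin_le A v; nia.
have : \sum_(v in ~: A) degin A v * surplus A v <=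
    D * \sum_(v in ~: A) (degin A v - 2).
  rewrite big_distrr /=; apply: leq_sum => v; rewrite inE /surplus => /negPf ->.
  by have := degin_le A v; nia.
rewrite (eq_bigl (fun v => v \notin A)); last by move=> v; rewrite inE.
nia.
Qed.

Hypothesis smallA : forall z, z \in A -> 8 * degin A z <= D.

(** Surpluses inside [A] are now at most D/2, which matches the weights 1 and 2 in [mad_sparse] and
    halves the surplus term. *)
Lemma square_clique_3D : #|A| <= 3 * D.
Proof.
have := mad_sparse eG madG A0; have := sum_cover.
rewrite (bigID (mem A)) /=.
have : 2 * (\sum_(v in A) degin A v * surplus A v) <= D * \sum_(v in A) degin A v.
  rewrite !big_distrr /=; apply: leq_sum => v vA; rewrite /surplus vA.
  by have := smallA vA; nia.
have : \sum_(v in ~: A) degin A v * surplus A v <=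
    D * \sum_(v in ~: A) (degin A v - 2).
  rewrite big_distrr /=; apply: leq_sum => v; rewrite inE /surplus => /negPf ->.
  by have := degin_le A v; nia.
rewrite (eq_bigl (fun v => v \notin A)); last by move=> v; rewrite inE.
nia.
Qed.

Definition charge (v : T) : nat :=
  if v \in A then D %/ 2 else D * (degin A v - 2) %/ degin A v.

Lemma charge_total : \sum_(x in A) \sum_(v | e x v) charge v < 2 * D * #|A|.
Proof.
rewrite sum_nbrs // (bigID (mem A)) /=; have := mad_sparse eG madG A0.
have : 2 * (\sum_(v in A) degin A v * charge v) <= D * \sum_(v in A) degin A v.
  rewrite !big_distrr /=; apply: leq_sum => v vA; rewrite /charge vA.
  by have := leq_trunc_div D 2; nia.
have : \sum_(v in ~: A) degin A v * charge v <= D * \sum_(v in ~: A) (degin A v - 2).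
  rewrite big_distrr /=; apply: leq_sum => v; rewrite inE /charge => /negPf ->.
  by rewrite mulnC leq_trunc_div.
rewrite (eq_bigl (fun v => v \notin A)); last by move=> v; rewrite inE.
nia.
Qed.

(** The loss 2D/d is below 8, since 4d > D on hubs. *)
Lemma charge_hub v : v \in hubs -> D - 8 <= charge v.
Proof.
rewrite !inE /charge => /andP[/negPf -> big].
have [D8|D8] := leqP D 8; first by rewrite (eqP D8).
rewrite leq_divRL; last lia.
have : 2 * D <= 8 * degin A v by lia.
by rewrite mulnBl mulnBr; lia.
Qed.

Lemma surplus_hub v : v \in hubs -> surplus A v <= D - 2.
Proof. by rewrite !inE /surplus => /andP[/negPf -> _]; have := degin_le A v; lia. Qed.

(** Outside [A], D/d >= 4 off the hubs; inside [A], [smallA] gives 4d <= D/2. *)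
Lemma charge_nonhub v : v \notin hubs -> 4 * surplus A v <= charge v.
Proof.
rewrite !inE /charge /surplus; have [vA _|vA /= small] := boolP (v \in A).
  by have := smallA vA; lia.
have [d0|d0] := posnP (degin A v); first by rewrite d0.
rewrite leq_divRL //; nia.
Qed.

(** The fraction (d - 2)/d is least at d = 3. *)
Lemma charge_nontrivial v : (v \in A) || (2 < degin A v) -> D %/ 3 <= charge v.
Proof.
rewrite /charge; have [vA _|vA /= d2] := boolP (v \in A); first lia.
rewrite leq_divRL; last lia.
by have := leq_trunc_div D 3; nia.
Qed.

Hypotheses (D24 : 24 <= D) (largeA : 5 * D + 2 <= 2 * #|A|).

(** By [clique_cover], non-hubs must supply surplus at least 3D/2 if [x] has no hub and more than
    D/2 if it has one, and they carry four times that in charge. Two hubs give 2D - 16, and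
    abnormality then adds a neighbour as in [charge_nontrivial]. Three hubs give 3D - 24, enough for
    [D24]. *)
Lemma charge_at x : x \in A ->
  2 * D - 16 + ~~ normal x * (D %/ 3) <= \sum_(v | e x v) charge v.
Proof.
move=> xA; have cov := clique_cover eG cA degD xA.
have splitF (F : T -> nat) : \sum_(v | e x v) F v =
    \sum_(v in hubs_of x) F v + \sum_(v | e x v && (v \notin hubs)) F v.
  rewrite (bigID (mem hubs)) /=; congr (_ + _).
  by apply: eq_bigl => v; rewrite [in RHS]inE andbC.
have hubF : #|hubs_of x| * (D - 8) <= \sum_(v in hubs_of x) charge v.
  rewrite -sum_nat_const; apply: leq_sum => v.
  by rewrite inE => /andP[/charge_hub].
have hubS : \sum_(v in hubs_of x) surplus A v <= #|hubs_of x| * (D - 2).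
  rewrite -sum_nat_const; apply: leq_sum => v.
  by rewrite inE => /andP[/surplus_hub].
have rest : 4 * (\sum_(v | e x v && (v \notin hubs)) surplus A v) <=
    \sum_(v | e x v && (v \notin hubs)) charge v.
  by rewrite big_distrr; apply: leq_sum => v /andP[_ /charge_nonhub].
rewrite splitF in cov; rewrite splitF.
have [nx|nnx] := boolP (normal x).
  move: nx => /andP[/eqP two _]; rewrite two in hubF; lia.
have [b0|b1|two|b3] : [\/ #|hubs_of x| = 0, #|hubs_of x| = 1,
    #|hubs_of x| = 2 | 3 <= #|hubs_of x|].
- by case: #|hubs_of x| => [|[|[|n]]]; constructor.
- rewrite b0 in hubF hubS; lia.
- rewrite b1 in hubF hubS; lia.
- move: nnx; rewrite /normal two eqxx /= => /forallPn[v].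
  rewrite negb_imply negb_or negb_and negbK -ltnNge => /andP[exv /andP[vH vbad]].
  have := charge_nontrivial vbad.
  rewrite two in hubF.
  have -> : \sum_(v0 | e x v0 && (v0 \notin hubs)) charge v0 =
     charge v + \sum_(v0 | e x v0 && (v0 \notin hubs) && (v0 != v)) charge v0.
    by rewrite (bigD1 v) // exv vH.
  lia.
- nia.
Qed.

(** The deficit of 16 per vertex totals at most 16 * 3D by [square_clique_3D]. *)
Lemma abnormal_count : #|A :\: normals| * (D %/ 3) < 48 * D.
Proof.
have le : #|A| * (2 * D - 16) + #|A :\: normals| * (D %/ 3) <=
    \sum_(x in A) \sum_(v | e x v) charge v.
  have : \sum_(x in A) (2 * D - 16 + ~~ normal x * (D %/ 3)) <=
      \sum_(x in A) \sum_(v | e x v) charge v.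
    by apply: leq_sum => x; apply: charge_at.
  apply: leq_trans.
  rewrite big_split /= sum_nat_const leq_add2l -big_distrl /= leq_mul2r.
  apply/orP; right; rewrite -sum1_card big_mkcond [leqRHS]big_mkcond.
  by apply: leq_sum => x _; rewrite !inE; case: (x \in A); case: normal.
have := charge_total; have := square_clique_3D; nia.
Qed.

End SquareClique.

(** * Reduction to small inner degrees and conclusion *)

Lemma small_degree_clique (T : finType) (e : rel T) (A : {set T}) (D : nat) :
  simple_graph e -> (mad e < 4)%R -> 0 < D -> max_deg e <= D ->
  is_clique (square e) A ->
  (forall z, z \in A -> 8 * degin e A z <= D) ->
  200 <= D -> 2 * #|A| <= 5 * D + 400.
Proof.
move=> eG madG D0 degD cA smallA D200; rewrite leqNgt; apply/negP => large.
have A0 : A != set0 by rewrite -card_gt0; lia.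
have largeA : 5 * D + 2 <= 2 * #|A| by lia.
have D24 : 24 <= D by lia.
have := abnormal_count eG degD cA madG D0 A0 smallA D24 largeA.
have := normals_bound eG degD cA.
have sub : normals e D A \subset A by apply/subsetP => x; rewrite inE => /andP[].
have := cardsID (normals e D A) A; rewrite (setIidPr sub).
(* As D >= 200, rounding is harmless and fewer than 200 vertices are abnormal. *)
have : 3 * (D %/ 3) + 2 >= D by lia.
nia.
Qed.

Lemma sum_degin_remove (T : finType) (e : rel T) (A : {set T}) (z : T) :
  simple_graph e -> z \in A ->
  \sum_(y in A) degin e A y =
    \sum_(y in A :\ z) degin e (A :\ z) y + 2 * degin e A z.
Proof.
move=> eG zA; rewrite (big_setD1 z zA) /= mul2n -addnn addnC addnA; congr (_ + _).
have -> : degin e A z = \sum_(y in A :\ z) (e y z : nat).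
  rewrite /degin -sum1_card big_mkcond [RHS]big_mkcond; apply: eq_bigr => y _.
  rewrite !inE [e y z]eG.1; have [->|_] := eqVneq y z; first by rewrite eG.2 andbF.
  by case: (y \in A); case: (e z y).
rewrite -big_split; apply: eq_bigr => y _ /=.
rewrite /degin (cardsD1 z) !inE zA addnC; congr (_ + _).
by apply: eq_card => x; rewrite !inE andbA.
Qed.

Lemma square_clique_bound (T : finType) (e : rel T) (K : {set T}) (D : nat) :
  simple_graph e -> (mad e < 4)%R -> 0 < D -> max_deg e <= D ->
  is_clique (square e) K -> 2 * #|K| <= 5 * D + 1064.
Proof.
move=> eG madG D0 degD cK; rewrite leqNgt; apply/negP => large.
have K0 : K != set0 by rewrite -card_gt0; lia.
have crude := square_clique_5D eG degD cK madG D0 K0.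
(* Removing z from A lowers the cost by 8 d(z) - D. *)
pose cost (A : {set T}) := 4 * (\sum_(y in A) degin e A y) + D * #|K :\: A|.
have [A AK Amin] := arg_minnP (P := fun A : {set T} => A \subset K) cost (subxx K).
have costK := Amin K (subxx K).
have sparse := mad_sparse eG madG K0.
(* By minimality [D * #|K :\: A|] is at most the cost of [K], which is below [16 * #|K|], hence
   below 80D. *)
have lost : #|K :\: A| < 80.
  move: costK; rewrite /cost setDv cards0; nia.
have cA : is_clique (square e) A.
  apply/forall_inP => x xA; apply/forall_inP => y yA.
  have /forall_inP /(_ x (subsetP AK x xA)) /forall_inP := cK.
  by apply; apply: (subsetP AK).
have smallA z : z \in A -> 8 * degin e A z <= D.
  move=> zA; have := Amin (A :\ z) (subset_trans (subD1set A z) AK).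
  rewrite /cost (sum_degin_remove eG zA).
  have -> : K :\: (A :\ z) = z |: (K :\: A).
    apply/setP => y; rewrite !inE; have [->|//] := eqVneq y z.
    by rewrite (subsetP AK).
  rewrite cardsU1 !inE zA /=; lia.
(* For D < 200 the bound [crude] already suffices, as 10D <= 5D + 1000. *)
have := small_degree_clique eG madG D0 degD cA smallA.
have := cardsID A K; rewrite (setIidPr AK); lia.
Qed.

Local Open Scope ring_scope.

Theorem theorem2 (D : nat) (T : finType) (e : rel T) :
  (0 < D)%N -> simple_graph e ->
  mad e < 4 -> (max_deg e <= D)%N ->
  (clique_number (square e))%:R <= (5 / 2 : rat) * D%:R + 532.
Proof.
move=> D0 eG madG degD.
have : (2 * clique_number (square e) <= 5 * D + 1064)%N.
  rewrite /clique_number; elim/big_ind: _ => // [x y|K]; first lia.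
  exact: square_clique_bound.
rewrite -(ler_nat rat) natrD !natrM; lra.
Qed.
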